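(* For every positive integer $r$ there exists a positive integer $k_0$ such that for every integer $k \ge k_0$ there exists a $k$-chromatic vertex-critical graph $G$ such that $\chi(G-R)=k$ for every set $R \subseteq E(G)$ with $|R|\le r$.
   Context: Graphs are finite and simple; $\chi$ denotes the chromatic number. A graph $G$ is called $k$-chromatic vertex-critical if $\chi(G)=k$ but $\chi(G-v)=k-1$ for every vertex $v\in V(G)$. For $R\subseteq E(G)$, $G-R$ denotes the graph obtained from $G$ by deleting the edges in $R$. *)

(* Defs.v *)
From mathcomp Require Import all_boot.

Set Implicit Arguments.
Unset Strict Implicit.
Unset Printing Implicit Defensive.

Record sgraph := SGraph {
  vertex :> finType;
  adj : rel vertex;
  adj_sym : symmetric adj;
  adj_irrefl : irreflexive adj
}.

(* An edge is the two-element set of its endpoints. *)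
Definition edges (G : sgraph) : {set {set G}} :=
  [set e | [exists x, [exists y, adj x y && (e == [set x; y])]]].

Definition proper_coloring (G : sgraph) (n : nat) (c : {ffun G -> 'I_n}) : bool :=
  [forall x, forall y, adj x y ==> (c x != c y)].

Definition colorable (G : sgraph) (n : nat) : bool :=
  [exists c : {ffun G -> 'I_n}, proper_coloring c].

Lemma colorable_card (G : sgraph) : exists n, colorable G n.
Proof.
exists #|G|; apply/existsP; exists [ffun x => enum_rank x].
apply/forallP => x; apply/forallP => y; apply/implyP => xy.
rewrite !ffunE; apply: contraTneq xy => /enum_rank_inj ->.
by rewrite adj_irrefl.
Qed.

Definition chi (G : sgraph) : nat := ex_minn (colorable_card G).

Section DeleteVertex.
Variables (G : sgraph) (v : G).

Definition del_vertex_adj : rel {x : G | x != v} :=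
  fun x y => adj (val x) (val y).

Lemma del_vertex_sym : symmetric del_vertex_adj.
Proof. by move=> x y; apply: adj_sym. Qed.

Lemma del_vertex_irrefl : irreflexive del_vertex_adj.
Proof. by move=> x; apply: adj_irrefl. Qed.

Definition del_vertex : sgraph := SGraph del_vertex_sym del_vertex_irrefl.

End DeleteVertex.

Section DeleteEdges.
Variables (G : sgraph) (R : {set {set G}}).

Definition del_edges_adj : rel G :=
  fun x y => adj x y && ([set x; y] \notin R).

Lemma del_edges_sym : symmetric del_edges_adj.
Proof. by move=> x y; rewrite /del_edges_adj adj_sym setUC. Qed.

Lemma del_edges_irrefl : irreflexive del_edges_adj.
Proof. by move=> x; rewrite /del_edges_adj adj_irrefl. Qed.

Definition del_edges : sgraph := SGraph del_edges_sym del_edges_irrefl.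

End DeleteEdges.

(* The predecessor is truncated, but harmlessly: chi G = 0 only when G has no
   vertex, and then the second clause is vacuous. *)
Definition vertex_critical (k : nat) (G : sgraph) : Prop :=
  chi G = k /\ forall v : G, chi (del_vertex v) = k.-1.

(* Main.v *)
Require Import Defs.
From mathcomp Require Import all_boot all_order all_algebra zify.

Set Implicit Arguments.
Unset Strict Implicit.
Unset Printing Implicit Defensive.

(** Work in the complement graph [g], on [s * m + 1] vertices.  If [g - v] is
    partitioned into [m] cliques of size [s] for each [v], then the complement
    of [g - v] is [m]-colourable, while [m] colours on the whole vertex set
    force a colour class of more than [s] vertices.  Deleting [r] edges of the
    complement cannot create such a class if every large clique of [g] lies in
    a set [Q] of at most [s] vertices such that each vertex outside [Q] has
    more than [r] non-neighbours in the clique: remove from the class one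
    endpoint of each deleted edge, and look at a vertex of the class outside
    the [Q] of what remains.

    Such a [g] with [s = p ^ 2] and [m = c ^ 2] is the Cayley graph on Z/n,
    [q = c * p], [n = q ^ 2 + 1], with connection set
    [{i + j q : |i|, |j| < p}].  Locally it is the plane grid in which two
    points are adjacent when they lie in a common [p * p] square; and Z/n minus
    a point is the [q * q] square [1 + {i + j q : 0 <= i, j < q}], tiled by
    [c ^ 2] squares of side [p].  Gluing two such graphs at a vertex adds the
    values of [m], and [8 ^ 2] and [9 ^ 2] are coprime, so all large [m]
    occur. *)

(* The second clause encodes a partition of [T] minus [v] into [m] cliques by a
   labelling [f]; the value of [f] at [v] is irrelevant. *)
Definition factor_critical (T : finType) (g : rel T) (s m r : nat) : Prop :=
  [/\ #|T| = s * m + 1,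
      forall v, exists2 f : T -> nat,
        forall x, x != v -> f x < m &
        forall x y, x != v -> y != v -> f x = f y -> g x y &
      forall K : {set T}, {in K &, forall x y, g x y} -> s < #|K| + r ->
        exists Q : {set T}, [/\ K \subset Q, #|Q| <= s &
          forall z, z \notin Q -> r < #|[set y in K | ~~ g z y]|]].

Definition attainable (s r m : nat) : Prop :=
  exists (T : finType) (g : rel T),
    [/\ reflexive g, symmetric g & factor_critical g s m r].

Lemma dist_divn (p a b : nat) : 0 < p -> a %/ p = b %/ p ->
  `|(b%:Z - a%:Z)%R| < p.
Proof.
move=> p_gt0 e; rewrite (divn_eq a p) (divn_eq b p) e {e}.
move: (ltn_pmod a p_gt0) (ltn_pmod b p_gt0).
by move: (a %% p) (b %% p) (b %/ p * p) => *; lia.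
Qed.

(** * The toroidal grid *)

Section Torus.
Variables p c : nat.
Hypotheses (p_gt0 : 0 < p) (c_ge8 : 8 <= c).
Let q := c * p.
Let n := (q ^ 2).+1.
Import GRing.Theory Num.Theory.
Local Open Scope ring_scope.

Let q_ge8p : (8 * p <= q)%N. Proof. by rewrite leq_mul2r c_ge8 orbT. Qed.
Let n_gt1 : (1 < n)%N.
Proof. by rewrite ltnS expn_gt0 /q muln_gt0 p_gt0 andbT; lia. Qed.

(** Homomorphism from the plane grid onto Z/n; its kernel is spanned by (1, q) and (q, -1). *)
Definition lat (i j : int) : 'Z_n := (i + j * q%:Z)%:~R.

Lemma lat0 : lat 0 0 = 0.
Proof. by rewrite /lat mul0r. Qed.

Lemma latD i j i' j' : lat (i + i') (j + j') = lat i j + lat i' j'.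
Proof. by rewrite /lat -intrD; congr (_%:~R); lia. Qed.

Lemma latB i j i' j' : lat (i - i') (j - j') = lat i j - lat i' j'.
Proof. by rewrite /lat -intrB; congr (_%:~R); lia. Qed.

(** As [8 * p <= q], the integer i + j q has absolute value at most 5p + 5pq < n, so divisibility by
    [n] makes it 0; a nonzero [j] would then give q <= |i| <= 5p. *)
Lemma lat_eq0 i j : (`|i| <= 5 * p)%N -> (`|j| <= 5 * p)%N ->
  lat i j = 0 -> i = 0 /\ j = 0.
Proof.
move=> hi hj; rewrite /lat => h0.
have dvd : (n %| `|(i + j * q%:Z)%R|)%N.
  have : (`|(i + j * q%:Z)%R|%N)%:R = 0 :> 'Z_n.
    case: (intP (i + j * q%:Z)) h0 => [|k|k] //=.
    by rewrite mulrNz => /eqP; rewrite oppr_eq0 => /eqP.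
  by move/(congr1 (@nat_of_ord _)); rewrite val_Zp_nat // => /eqP.
have jq : (`|(j * q%:Z)%R| <= 5 * p * q)%N by rewrite abszM leq_mul2r hj orbT.
have qn : (8 * p * q <= q * q)%N by rewrite leq_mul2r q_ge8p orbT.
have pq : (8 * p * p <= p * q)%N by rewrite [(p * q)%N]mulnC leq_mul2r q_ge8p orbT.
have pp : (p <= p * p)%N by rewrite leq_pmulr.
have small : (`|(i + j * q%:Z)%R| < n)%N.
  by rewrite /n expnS expn1; lia.
have {dvd small} t0 : i + j * q%:Z = 0.
  case: (posnP `|(i + j * q%:Z)%R|) => [/eqP|t_gt0].
    by rewrite absz_eq0 => /eqP.
  by have := dvdn_leq t_gt0 dvd; lia.
have j0 : j = 0.
  case: (eqVneq j 0) => // jn0.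
  have : (q <= `|(j * q%:Z)%R|)%N by rewrite abszM leq_pmull // absz_gt0.
  by lia.
by split=> //; move: t0; rewrite j0 mul0r addr0.
Qed.

Lemma lat_inj i j i' j' :
  (`|(i - i')%R| <= 5 * p)%N -> (`|(j - j')%R| <= 5 * p)%N ->
  lat i j = lat i' j' -> i = i' /\ j = j'.
Proof.
move=> hi hj e; have := lat_eq0 hi hj; rewrite latB e subrr => /(_ erefl).
by case; lia.
Qed.

(** Offsets with |i|, |j| < p are written as differences of two points of the [p * p] square, so
    that the quantifiers range over finite types. *)
Definition close : rel 'Z_n := fun x y =>
  [exists a : 'I_p * 'I_p, exists b : 'I_p * 'I_p,
     y - x == lat a.1%:Z a.2%:Z - lat b.1%:Z b.2%:Z].

Lemma ord_diff (i : int) : (`|i| < p)%N -> exists a b : 'I_p, i = a%:Z - b%:Z.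
Proof.
move=> hi; case: i hi => k hk.
  by exists (Ordinal hk), (Ordinal p_gt0); rewrite subr0.
by exists (Ordinal p_gt0), (Ordinal hk); rewrite /= sub0r NegzE.
Qed.

Lemma closeP x y :
  reflect (exists i j, [/\ (`|i| < p)%N, (`|j| < p)%N & y = x + lat i j])
          (close x y).
Proof.
apply: (iffP existsP) => [[[a1 a2] /existsP[[b1 b2] /eqP e]]|[i [j [hi hj ->]]]].
  have := ltn_ord a1; have := ltn_ord a2; have := ltn_ord b1; have := ltn_ord b2.
  exists (a1%:Z - b1%:Z), (a2%:Z - b2%:Z); split; [lia..|].
  by rewrite latB -e subrKC.
have [a1 [b1 ->]] := ord_diff hi; have [a2 [b2 ->]] := ord_diff hj.
exists (a1, a2); apply/existsP; exists (b1, b2) => /=.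
by rewrite latB addrC addKr.
Qed.

Lemma close_sym : symmetric close.
Proof.
suff imp x y : close x y -> close y x by move=> x y; apply/idP/idP; apply: imp.
case/closeP => i [j [hi hj ->]]; apply/closeP; exists (- i), (- j).
split; [lia..|].
by rewrite -addrA -latD !subrr lat0 addr0.
Qed.

Lemma close_refl : reflexive close.
Proof.
move=> x; apply/closeP; exists 0, 0; split=> //.
by rewrite lat0 addr0.
Qed.

Lemma close_tiling (v : 'Z_n) : exists2 f : 'Z_n -> nat,
  forall x, x != v -> (f x < c ^ 2)%N &
  forall x y, x != v -> y != v -> f x = f y -> close x y.
Proof.
(* [t x] numbers the points other than [v] from 0, starting at [v + 1]; its base [q] digits are the
   grid coordinates, and [f] below indexes the tile containing them. *)
pose t (x : 'Z_n) := (val (x - v)).-1.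
have q_gt0 : (0 < q)%N by lia.
have c_gt0 : (0 < c)%N by lia.
have pos (x : 'Z_n) : x != v -> (0 < val (x - v)%R)%N.
  by rewrite -subr_eq0 lt0n; apply: contra => /eqP e; apply/eqP/val_inj.
have t_lt x : x != v -> (t x < q * q)%N.
  move=> /pos; have : (val (x - v)%R < n)%N.
    exact: leq_trans (ltn_ord _) (eq_leq (Zp_cast n_gt1)).
  by rewrite /t; case: (val _).
have tE x : x != v -> x = v + (t x).+1%:R.
  by move=> /pos; rewrite /t => /prednK ->; rewrite natr_Zp subrKC.
pose f x := (t x %/ q %/ p * c + t x %% q %/ p)%N.
have lt_c a : (a < q -> a %/ p < c)%N by rewrite ltn_divLR.
have f1 x : (t x %% q %/ p < c)%N by rewrite lt_c // ltn_mod.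
have f2 x : x != v -> (t x %/ q %/ p < c)%N.
  by move=> xv; rewrite lt_c // ltn_divLR // t_lt.
exists f => [x xv|x y xv yv fxy].
  have : (t x %/ q %/ p * c <= c.-1 * c)%N.
    by rewrite leq_mul2r; have := f2 _ xv; lia.
  have := f1 x; rewrite /f expnS expn1 => h1 h2.
  have : (c * c = c.-1 * c + c)%N by rewrite -{1}(prednK c_gt0) mulSn addnC.
  by lia.
have e1 : (t x %% q %/ p = t y %% q %/ p)%N.
  by have := congr1 (modn^~ c) fxy; rewrite /f /= !modnMDl !(@modn_small _ c) ?f1.
have e2 : (t x %/ q %/ p = t y %/ q %/ p)%N.
  apply/eqP; rewrite -(eqn_pmul2r c_gt0) -(eqn_add2r (t x %% q %/ p)) {2}e1.
  exact/eqP.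
apply/closeP.
exists ((t y %% q)%:Z - (t x %% q)%:Z), ((t y %/ q)%:Z - (t x %/ q)%:Z).
split; [exact: dist_divn|exact: dist_divn|].
have tq z : (t z)%:R = lat (t z %% q)%N (t z %/ q)%N.
  by rewrite /lat {1}(divn_eq (t z) q) -PoszM -PoszD addnC.
rewrite latB -!tq {1}(tE _ xv) {1}(tE _ yv) -!natr1 -addrA.
by congr (_ + _); rewrite addrAC subrKC.
Qed.

(** An offset of [close] moves each coordinate by less than [p], so the bound [4 * p] stays within
    the [5 * p] of [lat_inj]. *)
Lemma closeN x i j i' j' :
  (`|(i' - i)%R| <= 4 * p)%N -> (`|(j' - j)%R| <= 4 * p)%N ->
  (p <= `|(i' - i)%R|)%N || (p <= `|(j' - j)%R|)%N ->
  ~~ close (x + lat i j) (x + lat i' j').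
Proof.
move=> hi hj far; apply/closeP => -[k [l [hk hl]]].
rewrite -addrA -latD => /addrI /lat_inj [||]; lia.
Qed.

Lemma close_dist x i j i' j' :
  (`|i| < p)%N -> (`|j| < p)%N -> (`|i'| < p)%N -> (`|j'| < p)%N ->
  close (x + lat i j) (x + lat i' j') ->
  (`|(i' - i)%R| < p)%N /\ (`|(j' - j)%R| < p)%N.
Proof.
move=> hi hj hi' hj' cxy; apply/andP; apply: contraTT cxy => far.
by apply: closeN; lia.
Qed.

(** Coordinates in [K] differ by less than [p], so [K] lies in a [p * p] square [Q] and misses fewer
    than [r] of its points. A vertex outside [Q] is close to nothing in [K], or far from a whole
    side of [Q], of which more than p - r >= r points are in [K]. *)
Lemma close_near_clique (r : nat) (K : {set 'Z_n}) :
  (2 * r <= p)%N -> {in K &, forall x y, close x y} -> (p ^ 2 < #|K| + r)%N ->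
  exists Q : {set 'Z_n}, [/\ K \subset Q, (#|Q| <= p ^ 2)%N &
    forall z, z \notin Q -> (r < #|[set y in K | ~~ close z y]|)%N].
Proof.
move=> rp cK Kbig.
have pp : (p <= p ^ 2)%N by rewrite expnS expn1 leq_pmulr.
have [x0 x0K] : exists x0, x0 \in K by apply/card_gt0P; lia.
have /fin_all_exists [co coP] (x : 'Z_n) : exists ij : int * int, x \in K ->
    [/\ (`|ij.1| < p)%N, (`|ij.2| < p)%N & x = x0 + lat ij.1 ij.2].
  case: (boolP (x \in K)) => [xK|_]; last by exists (0, 0).
  by have /closeP [i [j ij]] := cK _ _ x0K xK; exists (i, j).
have diam x y : x \in K -> y \in K ->
    (`|((co y).1 - (co x).1)%R| < p)%N /\ (`|((co y).2 - (co x).2)%R| < p)%N.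
  move=> xK yK; have := cK _ _ xK yK.
  have [hi hj {1}->] := coP _ xK; have [hi' hj' {1}->] := coP _ yK.
  exact: close_dist.
have [x1 x1K min1] : exists2 x1, x1 \in K &
    forall y, y \in K -> (co x1).1 <= (co y).1.
  case: (Order.TotalTheory.arg_minP (fun x => (co x).1) x0K) => x1 ? h.
  by exists x1.
have [x2 x2K min2] : exists2 x2, x2 \in K &
    forall y, y \in K -> (co x2).2 <= (co y).2.
  case: (Order.TotalTheory.arg_minP (fun x => (co x).2) x0K) => x2 ? h.
  by exists x2.
set a := (co x1).1 in min1; set b := (co x2).2 in min2.
have [ha _ _] := coP _ x1K; have [_ hb _] := coP _ x2K.
rewrite -/a in ha; rewrite -/b in hb.
pose sq (u v : 'I_p) : 'Z_n := x0 + lat (a + u%:Z) (b + v%:Z).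
pose Q := [set sq uv.1 uv.2 | uv : 'I_p * 'I_p].
have sqQ u v : sq u v \in Q by apply/imsetP; exists (u, v).
have KQ : K \subset Q.
  apply/subsetP => x xK; have [_ _ {1}->] := coP _ xK.
  have [d1 _] := diam _ _ x1K xK; have [_ d2] := diam _ _ x2K xK.
  have := min1 _ xK; have := min2 _ xK; rewrite -/a -/b in d1 d2 * => m2 m1.
  have h1 : (`|((co x).1 - a)%R| < p)%N by [].
  have h2 : (`|((co x).2 - b)%R| < p)%N by [].
  have := sqQ (Ordinal h1) (Ordinal h2); rewrite /sq /=.
  by rewrite !gez0_abs ?subr_ge0 // !subrKC.
have Qs : (#|Q| <= p ^ 2)%N.
  by apply: leq_trans (leq_imset_card _ _) _; rewrite card_prod card_ord.
exists Q; split=> // z zQ.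
have line (l : 'I_p -> 'Z_n) : injective l -> (forall v, l v \in Q) ->
    (forall v, ~~ close z (l v)) -> (r < #|[set y in K | ~~ close z y]|)%N.
  move=> l_inj lQ lz; pose L := [set l v | v in 'I_p].
  have cL : #|L| = p by rewrite card_imset // card_ord.
  have LK : (#|L :|: K| <= p ^ 2)%N.
    apply: leq_trans Qs; apply/subset_leq_card; rewrite subUset KQ andbT.
    by apply/subsetP => _ /imsetP [v _ ->].
  have : (#|L :&: K| <= #|[set y in K | ~~ close z y]|)%N.
    apply/subset_leq_card/subsetP => _ /setIP [/imsetP [v _ ->] vK].
    by rewrite inE vK lz.
  move=> LKz; apply: leq_trans LKz; rewrite -(ltn_add2l #|L :|: K|) cardsUI cL.
  apply: leq_ltn_trans (leq_add LK (leqnn r)) _.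
  move: Kbig rp; move: #|K| (p ^ 2)%N; lia.
case: (boolP [exists y in K, close z y])
  => [/existsP [y /andP [yK zy]]|none]; last first.
  apply: leq_trans (_ : #|K| <= _)%N; first by lia.
  apply/subset_leq_card/subsetP => y yK; rewrite inE yK /=.
  by apply: contra none => zy; apply/existsP; exists y; rewrite yK.
(* [3 * p] leaves room for one more coordinate below [p] within the [4 * p] of [closeN]. *)
have [zi [zj [hzi hzj ez]]] : exists zi zj,
    [/\ (`|(zi - a)%R| <= 3 * p)%N, (`|(zj - b)%R| <= 3 * p)%N &
        z = x0 + lat zi zj].
  move: zy; rewrite close_sym => /closeP [i [j [hi hj ->]]].
  have [d1 _] := diam _ _ x1K yK; have [_ d2] := diam _ _ x2K yK.
  rewrite -/a -/b in d1 d2.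
  have [_ _ {1}->] := coP _ yK; rewrite -addrA -latD.
  by exists ((co y).1 + i), ((co y).2 + j); split=> //; lia.
have dist_ord k (v v' : 'I_p) : (`|(k + v%:Z - (k + v'%:Z))%R| <= 5 * p)%N.
  by clear; have := ltn_ord v; have := ltn_ord v'; lia.
have inj1 u : injective (sq u).
  by move=> v v' /addrI /lat_inj [//|//|_ /addrI [/val_inj]].
have inj2 v : injective (sq^~ v).
  by move=> u u' /addrI /lat_inj [//|//|/addrI [/val_inj]].
(* If [z] leaves the box [Q] through one side, the opposite side of [Q] is a
   line of [p] points all far from [z], of which fewer than [r] miss [K]. *)
have away (u v : 'I_p) :
    (p <= `|(a + u%:Z - zi)%R|)%N || (p <= `|(b + v%:Z - zj)%R|)%N ->
    ~~ close z (sq u v).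
  rewrite ez; apply: closeN; [clear -hzi|clear -hzj].
    by have := ltn_ord u; lia.
  by have := ltn_ord v; lia.
have p1 : (p.-1 < p)%N by rewrite ltn_predL.
(* Over the integers, [zi < a] puts column [p.-1] at distance at least [p]; when a + p <= zi, column
   0 serves. *)
have [h|h1] := ltrP zi a.
  by apply: (line (sq (Ordinal p1))) => // v; apply: away => /=; clear -h p1; lia.
have [h|h2] := lerP (a + p%:Z) zi.
  by apply: (line (sq (Ordinal p_gt0))) => // v; apply: away => /=; clear -h; lia.
have [h|h3] := ltrP zj b.
  by apply: (line (sq^~ (Ordinal p1))) => // u; apply: away => /=; clear -h p1; lia.
have [h|h4] := lerP (b + p%:Z) zj.
  by apply: (line (sq^~ (Ordinal p_gt0))) => // u; apply: away => /=; clear -h; lia.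
have g1 : (`|(zi - a)%R| < p)%N by lia.
have g2 : (`|(zj - b)%R| < p)%N by lia.
move: zQ; rewrite ez; have := sqQ (Ordinal g1) (Ordinal g2).
by rewrite /sq /= !gez0_abs ?subr_ge0 // !subrKC => ->.
Qed.
End Torus.

Lemma attainable_torus (p c r : nat) : 0 < p -> 8 <= c -> 2 * r <= p ->
  attainable (p ^ 2) r (c ^ 2).
Proof.
move=> p_gt0 c_ge8 rp.
exists 'Z_((c * p) ^ 2).+1, (@close p c).
split; [exact: close_refl|exact: close_sym|].
split; last by move=> K; apply: close_near_clique.
  rewrite card_ord Zp_cast ?ltnS ?expn_gt0 ?muln_gt0 ?p_gt0 ?andbT; last by lia.
  by rewrite expnMn mulnC addn1.
exact: close_tiling.
Qed.

(** With a single vertex, [r < s] makes the clique condition vacuous. This starts the induction for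
    multiples. *)
Lemma attainable0 (s r : nat) : r < s -> attainable s r 0.
Proof.
move=> rs; exists unit, (fun _ _ => true); split=> //; split.
- by rewrite card_unit muln0.
- by case; exists (fun=> 0) => -[].
move=> K _ Kbig; have := max_card K; rewrite card_unit => K1.
by move: Kbig; rewrite ltnNge (leq_trans (leq_add K1 (leqnn r))).
Qed.

(** Carries the clique condition from a piece to the glued graph: a vertex outside the piece has at
    most [i w] as a neighbour there, so it misses at least |K| - 1 > r vertices of [K], because 2r <
    s. *)
Lemma near_clique_embed (T1 T : finType) (i : T1 -> T) (g1 : rel T1) (g : rel T)
    (w : T1) (s r : nat) (K : {set T}) :
  injective i -> (forall x y, g (i x) (i y) = g1 x y) ->
  (forall z x, z \notin codom i -> x != w -> ~~ g z (i x)) ->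
  r + r < s ->
  (forall K1 : {set T1}, {in K1 &, forall x y, g1 x y} -> s < #|K1| + r ->
        exists Q : {set T1}, [/\ K1 \subset Q, #|Q| <= s &
          forall z, z \notin Q -> r < #|[set y in K1 | ~~ g1 z y]|]) ->
  K \subset codom i -> {in K &, forall x y, g x y} -> s < #|K| + r ->
  exists Q : {set T}, [/\ K \subset Q, #|Q| <= s &
    forall z, z \notin Q -> r < #|[set y in K | ~~ g z y]|].
Proof.
move=> i_inj gE cross rs near1 /subsetP Ki cK Kbig.
have KE : K = i @: (i @^-1: K).
  apply/setP => x; apply/idP/imsetP => [xK|[y]]; last by rewrite inE => ? ->.
  by have /codomP [y e] := Ki _ xK; exists y; rewrite // inE -e.
have cardK : #|K| = #|i @^-1: K| by rewrite {1}KE card_imset.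
have [x y||Q [KQ Qs out]] := near1 (i @^-1: K); rewrite -?cardK //.
  by rewrite !inE -gE => xK yK; apply: cK.
exists (i @: Q); split.
- by rewrite KE imsetS.
- by rewrite card_imset.
move=> z zQ; case: (boolP (z \in codom i)) => [/codomP [x ez]|zi].
  rewrite ez mem_imset // in zQ *.
  apply: leq_trans (out _ zQ) _; rewrite -(card_imset _ i_inj).
  apply/subset_leq_card/subsetP => _ /imsetP [y yP ->].
  by move: yP; rewrite !inE gE.
apply: leq_trans (_ : #|K :\ i w| <= _).
  by have := cardsD1 (i w) K; case: (i w \in K); lia.
apply/subset_leq_card/subsetP => y; rewrite !inE => /andP [yw yK].
have /codomP [x ey] := Ki _ yK; rewrite yK ey cross //.
by apply: contra yw => /eqP <-; rewrite ey.
Qed.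

(** * Gluing at a vertex *)

Section Glue.
Variables (T1 T2 : finType) (g1 : rel T1) (g2 : rel T2) (w1 : T1) (w2 : T2).

(** [w2] is dropped from the second piece, and [inl w1] stands for it. *)
Definition glue_type : finType := (T1 + {x : T2 | x != w2})%type.

Definition glue_rel : rel glue_type := fun x y =>
  match x, y with
  | inl a, inl b => g1 a b
  | inr a, inr b => g2 (val a) (val b)
  | inl a, inr b => (a == w1) && g2 w2 (val b)
  | inr a, inl b => (b == w1) && g2 (val a) w2
  end.

Definition glue_inr (x : T2) : glue_type :=
  if insub x is Some y then inr y else inl w1.

Lemma glue_inr_base : glue_inr w2 = inl w1.
Proof. by rewrite /glue_inr insubF // eqxx. Qed.

Lemma glue_inr_val (y : {x : T2 | x != w2}) : glue_inr (val y) = inr y.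
Proof. by rewrite /glue_inr valK. Qed.

Lemma glue_inrP (P : T2 -> Prop) :
  P w2 -> (forall y : {x : T2 | x != w2}, P (val y)) -> forall x, P x.
Proof.
move=> P0 P1 x; case: (eqVneq x w2) => [->|xw] //.
exact: (P1 (Sub x xw)).
Qed.

Lemma glue_inr_inj : injective glue_inr.
Proof.
apply: glue_inrP => [|x]; apply: glue_inrP => [|y];
  rewrite ?glue_inr_base ?glue_inr_val //.
by case=> ->.
Qed.

Hypotheses (refl1 : reflexive g1) (refl2 : reflexive g2).

Lemma glue_relr x y : glue_rel (glue_inr x) (glue_inr y) = g2 x y.
Proof.
move: x y; apply: glue_inrP => [|x]; apply: glue_inrP => [|y];
  by rewrite ?glue_inr_base ?glue_inr_val /= ?refl1 ?refl2 ?eqxx.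
Qed.

Lemma glue_refl : reflexive glue_rel.
Proof. by case=> x /=. Qed.

Lemma glue_sym : symmetric g1 -> symmetric g2 -> symmetric glue_rel.
Proof.
move=> s1 s2 [x|x] [y|y] /=; [exact: s1| | |exact: s2].
all: by congr (_ && _); apply: s2. Qed.

(** When [v] is deleted, the shared vertex is covered by the piece containing [v], and the other
    piece is partitioned without it. A clique lies in one piece, since no edge joins the two pieces
    away from the shared vertex. *)
Lemma glue_factor_critical (s m1 m2 r : nat) : r + r < s ->
  factor_critical g1 s m1 r -> factor_critical g2 s m2 r ->
  factor_critical glue_rel s (m1 + m2) r.
Proof.
move=> rs [c1 t1 near1] [c2 t2 near2]; split.
- have := cardC1 w2; rewrite c2 addn1 /= => e.
  by rewrite card_sum card_sig e c1 mulnDr; lia.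
- case=> v.
    have [f1 lt1 f1P] := t1 v; have [f2 lt2 f2P] := t2 w2.
    exists (fun x => match x with inl a => f1 a | inr b => m1 + f2 (val b) end).
      case=> x xv /=; first by have := lt1 x xv; lia.
      by rewrite ltn_add2l lt2 // (valP x).
    case=> x [y|y] /= xv yv.
    + exact: f1P.
    + by have := lt1 x xv; lia.
    + by have := lt1 y yv; lia.
    + by move/addnI/(f2P _ _ (valP x) (valP y)).
  have [f1 lt1 f1P] := t1 w1; have [f2 lt2 f2P] := t2 (val v).
  have wv : w2 != val v by rewrite eq_sym (valP v).
  (* [w1] now belongs to a clique of the second piece, so it takes the label of [w2]. *)
  exists (fun x => match x with
    | inl a => if a == w1 then m1 + f2 w2 else f1 a
    | inr b => m1 + f2 (val b) end).
    case=> x xv /=; last by rewrite ltn_add2l lt2.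
    by case: eqVneq => [_|/lt1]; [rewrite ltn_add2l lt2|lia].
  case=> x [y|y] /= xv yv.
  + case: (eqVneq x w1) => [->|xw]; case: (eqVneq y w1) => [->|yw] //.
    * by have := lt1 y yw; lia.
    * by have := lt1 x xw; lia.
    * exact: f1P.
  + case: (eqVneq x w1) => [_|xw]; last by have := lt1 x xw; lia.
    by move/addnI; apply: f2P.
  + case: (eqVneq y w1) => [_|yw]; last by have := lt1 y yw; lia.
    by move/addnI; apply: f2P.
  + by move/addnI; apply: f2P.
move=> K cK Kbig.
pose il : T1 -> glue_type := inl.
case: (boolP (K \subset codom il)) => [Kl|].
  apply: (near_clique_embed (w := w1) (inl_inj)) near1 Kl cK Kbig => //.
  move=> [z|z] x zl xw; first by rewrite codom_f in zl.
  by rewrite /= (negbTE xw).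
case/subsetPn => -[x xK xl|x xK _]; first by rewrite codom_f in xl.
apply: (near_clique_embed (w := w2) glue_inr_inj glue_relr) near2 _ (cK) Kbig => //.
  move=> [z|z] y zr yw; last by rewrite -glue_inr_val codom_f in zr.
  rewrite -[y]/(val (Sub y yw : {x : T2 | x != w2})) glue_inr_val /=.
  by apply: contra zr => /andP [/eqP -> _]; rewrite -glue_inr_base codom_f.
apply/subsetP => -[y|y] yK; last by rewrite -glue_inr_val codom_f.
by have /andP [/eqP -> _] := cK _ _ yK xK; rewrite -glue_inr_base codom_f.
Qed.
End Glue.

(** * Sums and multiples of attainable values *)

Lemma attainableD (s r m1 m2 : nat) : r + r < s ->
  attainable s r m1 -> attainable s r m2 -> attainable s r (m1 + m2).
Proof.
move=> rs [T1 [g1 [r1 s1 h1]]] [T2 [g2 [r2 s2 h2]]].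
have [c1 _ _] := h1; have [c2 _ _] := h2.
have /card_gt0P [w1 _] : 0 < #|T1| by rewrite c1 addn1.
have /card_gt0P [w2 _] : 0 < #|T2| by rewrite c2 addn1.
exists (glue_type T1 w2), (glue_rel g1 g2 w1 (w2 := w2)).
by split; [exact: glue_refl|exact: glue_sym|exact: glue_factor_critical].
Qed.

Lemma attainableM (s r m a : nat) : r + r < s ->
  attainable s r m -> attainable s r (a * m).
Proof.
move=> rs h; elim: a => [|a IH]; first by apply: attainable0; lia.
by rewrite mulSn; apply: attainableD.
Qed.

(* Solving [64 a + 81 b = m]: 49 is the inverse of 81 modulo 64. *)
Lemma attainable_large (r m : nat) : 0 < r -> 8 ^ 2 * 9 ^ 2 <= m ->
  attainable ((2 * r) ^ 2) r m.
Proof.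
move=> r_gt0 m_large.
have rs : r + r < (2 * r) ^ 2.
  by rewrite addnn -mul2n -{1}[2 * r]expn1 ltn_exp2l; lia.
have [a [b ->]] : exists a b, m = a * 8 ^ 2 + b * 9 ^ 2.
  (* The second coefficient is at most 63, so the subtracted term is below [8 ^ 2 * 9 ^ 2 <= m] and
     nothing is truncated. *)
  by exists ((m - (49 * m) %% 64 * 81) %/ 64), ((49 * m) %% 64); lia.
by apply: attainableD; rewrite //; apply: attainableM; rewrite //;
  apply: attainable_torus; lia.
Qed.

(** * Colourings of the complement *)

Section Complement.
Variables (T : finType) (g : rel T).
Hypotheses (g_refl : reflexive g) (g_sym : symmetric g).

Definition compl_adj : rel T := fun x y => ~~ g x y.

Lemma compl_sym : symmetric compl_adj.
Proof. by move=> x y; rewrite /compl_adj g_sym. Qed.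

Lemma compl_irrefl : irreflexive compl_adj.
Proof. by move=> x; rewrite /compl_adj g_refl. Qed.

Definition compl : sgraph := SGraph compl_sym compl_irrefl.

End Complement.

Lemma chi_eq (G : sgraph) (k : nat) :
  colorable G k -> (forall j, colorable G j -> k <= j) -> chi G = k.
Proof.
move=> Gk lb; rewrite /chi; case: ex_minnP => j /lb kj /(_ _ Gk) jk.
by apply/eqP; rewrite eqn_leq jk.
Qed.

Lemma colorable_nat (G : sgraph) (n : nat) (f : G -> nat) :
  (forall x, f x < n) -> (forall x y, adj x y -> f x <> f y) -> colorable G n.
Proof.
move=> lt fP; apply/existsP; exists [ffun x => Ordinal (lt x)].
apply/forallP => x; apply/forallP => y; apply/implyP => xy.
by rewrite !ffunE; apply/eqP => -[]; apply: fP.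
Qed.

Lemma colorable_del_edges (G : sgraph) (R : {set {set G}}) (n : nat) :
  colorable G n -> colorable (del_edges R) n.
Proof.
move=> /existsP [c /forallP cP]; apply/existsP; exists c.
apply/forallP => x; apply/forallP => y; apply/implyP => /andP [xy _].
by have /forallP /(_ y) := cP x; rewrite xy.
Qed.

Lemma large_color_class (G : sgraph) (s j : nat) :
  colorable G j -> s * j < #|G| ->
  exists K : {set G}, s < #|K| /\ {in K &, forall x y, ~~ adj x y}.
Proof.
move=> /existsP [c /forallP cP] big.
have [i ibig] : exists i, s < #|[set x | c x == i]|.
  apply/existsP; apply: contraLR big => /existsPn small; rewrite -leqNgt.
  rewrite -sum1_card (partition_big c predT) //=.
  apply: leq_trans (_ : \sum_(i < j) s <= _); last first.
    by rewrite sum_nat_const card_ord mulnC.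
  apply: leq_sum => i _; rewrite sum1_card -cardsE.
  by have := small i; rewrite -leqNgt.
exists [set x | c x == i]; split=> // x y; rewrite !inE => /eqP cx /eqP cy.
by have /forallP /(_ y) := cP x; rewrite cx cy eqxx implybF.
Qed.

Lemma no_large_near_clique (T : finType) (g : rel T) (s m r : nat)
    (R : {set {set T}}) (K : {set T}) :
  reflexive g -> factor_critical g s m r -> #|R| <= r -> s < #|K| ->
  ~ {in K &, forall x y, g x y || ([set x; y] \in R)}.
Proof.
move=> g_refl [_ _ near] Rr Ks cK.
(* [U] contains one endpoint of each edge of [R]. *)
pose O := [set [pick x in e] | e : {set T} in R].
pose U := Some @^-1: O.
have Ur : #|U| <= r.
  rewrite -(card_imset _ Some_inj); apply: leq_trans Rr.
  apply: leq_trans (leq_imset_card (fun e : {set T} => [pick x in e]) (mem R)).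
  by apply/subset_leq_card/subsetP => _ /imsetP [x xO ->]; rewrite inE in xO.
have [x y||Q [KQ Qs out]] := near (K :\: U).
- rewrite !inE => /andP [xU xK] /andP [yU yK].
  case/orP: (cK x y xK yK) => // /(imset_f (fun e : {set T} => [pick x in e])).
  rewrite -/O; case: pickP => [z|/(_ x)]; last by rewrite !inE eqxx.
  by rewrite !inE => /orP [] /eqP -> zO; rewrite zO in xU yU.
- by have := cardsID U K; have := subset_leq_card (subsetIr K U); lia.
have [z zK zQ] : exists2 z, z \in K & z \notin Q.
  apply/subsetPn; apply: contraL (leq_ltn_trans Qs Ks) => /subset_leq_card.
  by rewrite -leqNgt.
(* Each non-neighbour [y] of [z] gives a pair [[set z; y]] in [R], and distinct [y] give distinct
   pairs, so there are at most [r] of them. *)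
have := out z zQ; rewrite ltnNge => /negP; apply; apply: leq_trans Rr.
rewrite -(@card_in_imset _ _ (fun y => [set z; y])) => [|x y].
  apply/subset_leq_card/subsetP => _ /imsetP [y yP ->].
  move: yP; rewrite !inE => /andP [/andP [_ yK] nzy].
  by have := cK z y zK yK; rewrite (negbTE nzy).
rewrite !inE => /andP [_ nx] _ e.
have : x \in [set z; y] by rewrite -e !inE eqxx orbT.
by rewrite !inE => /orP [/eqP xz|/eqP]; first by rewrite xz g_refl in nx.
Qed.

Section ComplementChi.
Variables (T : finType) (g : rel T) (s m r : nat).
Hypotheses (g_refl : reflexive g) (g_sym : symmetric g) (s_gt0 : 0 < s).
Hypothesis crit : factor_critical g s m r.
Let G := compl g_refl g_sym.

(** The [m] cliques covering all but one vertex are colour classes; that vertex gets the extra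
    colour [m]. *)
Lemma colorable_compl : colorable G m.+1.
Proof.
have [c t _] := crit.
have /card_gt0P [v _] : 0 < #|T| by rewrite c addn1.
have [f lt fP] := t v.
apply: (@colorable_nat G _ (fun x => if x == v then m else f x)) => [x|x y nxy].
  by case: eqVneq => // /lt /ltnW.
case: (eqVneq x v) => [xv|xv]; case: (eqVneq y v) => [yv|yv].
- by move: nxy; rewrite /= /compl_adj xv yv g_refl.
- by have := lt y yv; lia.
- by have := lt x xv; lia.
- by move/(fP x y xv yv); apply/negP.
Qed.

Lemma compl_del_edges_lb (R : {set {set G}}) (j : nat) :
  #|R| <= r -> colorable (del_edges R) j -> m.+1 <= j.
Proof.
move=> Rr col; rewrite ltnNge; apply/negP => jm; have [c _ _] := crit.
have [|K [Ks Kind]] := large_color_class (s := s) col.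
  by rewrite /= c addn1 ltnS leq_mul2l jm orbT.
apply: (no_large_near_clique g_refl crit Rr Ks) => x y xK yK.
by have := Kind x y xK yK; rewrite /= /del_edges_adj /= /compl_adj negb_and !negbK.
Qed.

Lemma compl_chi_del_edges (R : {set {set G}}) :
  #|R| <= r -> chi (del_edges R) = m.+1.
Proof.
move=> Rr; apply: chi_eq => [|j]; last exact: compl_del_edges_lb.
exact/colorable_del_edges/colorable_compl.
Qed.

Lemma compl_vertex_critical : vertex_critical m.+1 G.
Proof.
split=> [|v].
  apply: chi_eq => [|j /(colorable_del_edges set0)]; first exact: colorable_compl.
  by apply: compl_del_edges_lb; rewrite cards0.
have [c t _] := crit; apply: chi_eq => [|j col].
  have [f lt fP] := t v.
  apply: (@colorable_nat (del_vertex v) _ (fun x => f (val x))) => [x|x y nxy].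
    exact: lt (valP x).
  by move/(fP _ _ (valP x) (valP y)); apply/negP.
(* With fewer than [m] colours, the [s * m] remaining vertices still force a class larger than [s],
   which is impossible in [G] with no edge deleted. *)
rewrite leqNgt; apply/negP => jm.
have [|K [Ks Kind]] := large_color_class (s := s) col.
  have := cardC1 (v : T); rewrite c addn1 /= => e.
  by rewrite /= card_sig e ltn_pmul2l.
apply: (@no_large_near_clique _ _ _ _ _ set0 (val @: K) g_refl crit).
- by rewrite cards0.
- by rewrite card_imset //; apply: val_inj.
move=> _ _ /imsetP [x xK ->] /imsetP [y yK ->].
by have := Kind x y xK yK; rewrite /= /del_vertex_adj /= /compl_adj negbK => ->.
Qed.
End ComplementChi.

Theorem theorem1 :
  forall r : nat, 0 < r ->
  exists k0 : nat, 0 < k0 /\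
    forall k : nat, k0 <= k ->
    exists G : sgraph,
      vertex_critical k G /\
      forall R : {set {set G}},
        R \subset edges G -> #|R| <= r -> chi (del_edges R) = k.
Proof.
(* The graph built from [m] has chromatic number [m.+1], whence the successor. *)
move=> r r_gt0; exists (8 ^ 2 * 9 ^ 2).+1; split=> // -[//|m] m_large.
have [T [g [g_refl g_sym crit]]] := attainable_large r_gt0 m_large.
have s_gt0 : 0 < (2 * r) ^ 2 by rewrite expn_gt0 muln_gt0 r_gt0.
exists (compl g_refl g_sym); split; first exact: compl_vertex_critical crit.
by move=> R _; apply: compl_chi_del_edges crit R.
Qed.
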